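(* Let $K$ be a number field or a function field of characteristic zero, and let $S=\{x^d+c_1,\dots,x^d+c_s\}$ with $c_1,\dots,c_s\in K$ and $d\geq2$. Assume $K$ contains a primitive $d$th root of unity, that $\gamma_n=\theta_1\circ\cdots\circ\theta_n$ (with $\theta_i\in S$) is irreducible over $K$ for some $n\geq2$, and that there is a prime $\mathfrak p$ of $\mathcal O_K$ such that: (1) $v_{\mathfrak p}(d)=0$; (2) $v_{\mathfrak p}(c_i)\geq0$ for all $1\leq i\leq s$; (3) $v_{\mathfrak p}(\gamma_n(0))>0$ and $\gcd(v_{\mathfrak p}(\gamma_n(0)),d)=1$; (4) $v_{\mathfrak p}(\gamma_m(0))=0$ for all $1\leq m\leq n-1$, where $\gamma_m=\theta_1\circ\cdots\circ\theta_m$. Then $[K(\gamma_n):K(\gamma_{n-1})]=d^{d^{n-1}}$, where $K(f)$ denotes the splitting field of $f$ over $K$.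
   Context: A function field is the function field $K$ of an integral curve over a field $k$. For a number field, $\mathcal O_K$ is its ring of integers; for a function field, a place $\mathfrak q_\infty$ (trivial on $k$) is fixed and $\mathcal O_K=\{\alpha\in K: v_{\mathfrak p}(\alpha)\geq0\text{ for all places }\mathfrak p\neq\mathfrak q_\infty\}$. $v_{\mathfrak p}$ is the normalized valuation of the prime $\mathfrak p$. *)

(* Defs.v *)
From HB Require Import structures.
From mathcomp Require Import all_boot all_order all_algebra all_field.

Set Implicit Arguments.
Unset Strict Implicit.
Unset Printing Implicit Defensive.

Import Order.TTheory GRing.Theory Num.Theory.
Local Open Scope ring_scope.

(* The value of a valuation v at 0 is conventionally +oo, so v 0 : int carries
   no information: v is only constrained, and only used, on nonzero elements.
   val_surj says that the value group is the whole of Z. *)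
Record normalized_valuation (K : fieldType) (v : K -> int) : Prop := {
  valM : forall x y, x != 0 -> y != 0 -> v (x * y) = v x + v y;
  valD : forall x y, x != 0 -> y != 0 -> x + y != 0 ->
           Num.min (v x) (v y) <= v (x + y);
  val_surj : forall m : int, exists2 x, x != 0 & v x = m
}.

(* v x >= 0 in Z union {+oo} *)
Definition val_ge0 (K : fieldType) (v : K -> int) (x : K) : Prop :=
  x = 0 \/ 0 <= v x.

Definition number_field (K : fieldType) : Prop :=
  exists (L : fieldExtType rat) (f : {rmorphism L -> K}), bijective f.

Definition ring_of_integers (K : fieldType) (x : K) : Prop :=
  integralOver (intr : int -> K) x.

(* y belongs to the subfield k(t) of K *)
Definition in_simple_ext (k K : fieldType) (iota : {rmorphism k -> K})
    (t y : K) : Prop :=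
  exists p q : {poly k},
    (map_poly iota q).[t] != 0 /\
    y = (map_poly iota p).[t] / (map_poly iota q).[t].

(* The function fields of integral curves over k are the finitely generated
   extensions of k of transcendence degree 1, i.e. the finite extensions of
   some k(t) with t transcendental over k. *)
Definition function_field (k K : fieldType) (iota : {rmorphism k -> K}) : Prop :=
  exists t : K,
    ~ algebraicOver iota t /\
    exists (m : nat) (e : 'I_m -> K), forall x : K,
      exists2 a : 'I_m -> K,
        (forall i, in_simple_ext iota t (a i)) & x = \sum_i a i * e i.

Definition place (k K : fieldType) (iota : {rmorphism k -> K}) (v : K -> int)
    : Prop :=
  normalized_valuation v /\ forall a : k, a != 0 -> v (iota a) = 0.

Definition distinct_places (K : fieldType) (v w : K -> int) : Prop :=
  exists2 x, x != 0 & v x <> w x.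

Definition regular_away (k K : fieldType) (iota : {rmorphism k -> K})
    (vinf : K -> int) (x : K) : Prop :=
  forall v : K -> int, place iota v -> distinct_places v vinf -> val_ge0 v x.

(* base_field K OK: K is a number field or a function field of characteristic
   zero (with a chosen place at infinity vinf), and OK is its ring O_K. *)
Inductive base_field (K : fieldType) : (K -> Prop) -> Prop :=
| NumberField : number_field K -> base_field (@ring_of_integers K)
| FunctionField (k : fieldType) (iota : {rmorphism k -> K}) (vinf : K -> int) :
    [pchar K] =i pred0 -> function_field iota -> place iota vinf ->
    base_field (regular_away iota vinf).

Record nonzero_prime_ideal (K : fieldType) (O P : K -> Prop) : Prop := {
  prime_sub : forall x, P x -> O x;
  prime_0 : P 0;
  prime_add : forall x y, P x -> P y -> P (x + y);
  prime_mul : forall a x, O a -> P x -> P (a * x);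
  prime_proper : ~ P 1;
  prime_prime : forall x y, O x -> O y -> P (x * y) -> P x \/ P y;
  prime_nonzero : exists2 x, P x & x != 0
}.

(* v is v_P: the normalized discrete valuation of K whose valuation ring is the
   localization of O at P (this determines v on nonzero elements). *)
Definition valuation_of_prime (K : fieldType) (O P : K -> Prop) (v : K -> int)
    : Prop :=
  normalized_valuation v /\
  forall x : K, val_ge0 v x <->
    exists a b : K, [/\ O a, O b, ~ P b & x = a / b].

(* theta_1 o ... o theta_m, for theta = [:: theta_1; ...; theta_n], m <= n *)
Definition gamma (K : fieldType) (theta : seq {poly K}) (m : nat) : {poly K} :=
  foldr (fun f g => f \Po g) 'X (take m theta).

(* E is K(f), the splitting field of f over K, inside an extension L of K *)
Definition is_splitting_field (K : fieldType) (L : fieldExtType K)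
    (f : {poly K}) (E : {subfield L}) : Prop :=
  splittingFieldFor 1%VS (map_poly (in_alg L) f) E.

(* Main.v *)
Require Import Defs.
From HB Require Import structures.
From mathcomp Require Import all_boot all_order all_algebra all_field.
From mathcomp Require Import ring.

(** Write [g] for [gamma_(n-1)], [b_1, ..., b_N] for its roots and [X^d + c] for
    [theta_n], so that [K(gamma_n)] is obtained from [F = K(g)] by adjoining the
    [d]-th roots of the [b_i - c]. By Kummer theory the degree is [d^N] as soon
    as the [b_i - c] are independent modulo [d]-th powers of [F].

    The product of the [b_i - c] is [gamma_n(0)] up to sign, of valuation [a]
    prime to [d]. By the chain rule and hypothesis (4) the differences
    [b_i - b_j] are units above the prime, so [F/K] is unramified there; here
    this takes the form: if [f^m] is divisible by a uniformizer [pi] among the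
    elements integral over the valuation ring, so is [f]. Suppose [y] in [F] and
    [y^d] is the product of the [(b_i - c)^(e_i)] with [d] not dividing [e_1].
    Comparing exponents of [pi], [B_1 = \prod_(j != 1) (b_j - c)] is divisible
    by [pi]; by irreducibility of [g] all its conjugates [B_i] are, hence so is
    their sum [+-g'(c)]. But [g'(c)] is a unit: otherwise [c] would be a critical
    point of [g] modulo the prime, and [gamma_n(0) = g(c)] would be congruent to
    some [gamma_k(0)] with [k < n], which is a unit. *)

Set Implicit Arguments.
Unset Strict Implicit.
Unset Printing Implicit Defensive.

Import Order.TTheory GRing.Theory Num.Theory.
Local Open Scope ring_scope.

(** * Discrete valuations *)

Section Valuation.

Variables (K : fieldType) (v : K -> int).
Hypothesis hv : normalized_valuation v.
Implicit Types x y : K.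

Lemma val_one : v 1 = 0.
Proof.
have := Defs.valM hv (oner_neq0 K) (oner_neq0 K); rewrite mulr1 => h.
by apply: (addrI (v 1)); rewrite addr0 -h.
Qed.

Lemma val_inv x : x != 0 -> v x^-1 = - v x.
Proof.
move=> x0; apply: (addrI (v x)); rewrite subrr -(Defs.valM hv) ?invr_eq0 //.
by rewrite divff // val_one.
Qed.

Lemma val_exp x n : x != 0 -> v (x ^+ n) = v x *+ n.
Proof.
move=> x0; elim: n => [|n IH]; first by rewrite expr0 val_one.
by rewrite exprS mulrS (Defs.valM hv) ?expf_neq0 // IH.
Qed.

Lemma val_opp x : v (- x) = v x.
Proof.
have [->|x0] := eqVneq x 0; first by rewrite oppr0.
have h1 : (-1 : K) != 0 by rewrite oppr_eq0 oner_neq0.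
rewrite -mulN1r (Defs.valM hv) //.
suff -> : v (-1) = 0 by rewrite add0r.
have := val_exp 2 h1; rewrite sqrrN expr1n val_one => /esym/eqP.
by rewrite mulrn_eq0 /= => /eqP.
Qed.

Lemma val_ge0P x : reflect (val_ge0 v x) ((x == 0) || (0 <= v x)).
Proof. by apply: (iffP orP) => -[]; [move/eqP; left|right|move/eqP; left|right]. Qed.

Lemma val_ge0_1 : val_ge0 v 1. Proof. by right; rewrite val_one. Qed.

Lemma val_ge0_mul x y : val_ge0 v x -> val_ge0 v y -> val_ge0 v (x * y).
Proof.
have [->|x0] := eqVneq x 0; first by rewrite mul0r.
have [->|y0] := eqVneq y 0; first by rewrite mulr0.
move=> [/eqP|hx]; first by rewrite (negPf x0).
move=> [/eqP|hy]; first by rewrite (negPf y0).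
by right; rewrite (Defs.valM hv) ?addr_ge0.
Qed.

Lemma val_ge0_sub x y : val_ge0 v x -> val_ge0 v y -> val_ge0 v (x - y).
Proof.
have [->|x0] := eqVneq x 0.
  rewrite sub0r => _ [->|hy]; first by rewrite oppr0; left.
  by right; rewrite val_opp.
have [->|y0] := eqVneq y 0; first by rewrite subr0.
have [->|xy0] := eqVneq (x - y) 0; first by left.
move=> [/eqP|hx]; first by rewrite (negPf x0).
move=> [/eqP|hy]; first by rewrite (negPf y0).
right; apply: le_trans (Defs.valD hv x0 _ xy0); last by rewrite oppr_eq0.
by rewrite val_opp le_min hx.
Qed.

(** The proof that [v] is a valuation is an argument, so that the subring structure, which depends
    on it, can be attached to the predicate. *)
Definition valuation_ring of normalized_valuation v : {pred K} :=
  fun x => (x == 0) || (0 <= v x).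

Lemma valuation_ring_subring : subring_closed (valuation_ring hv).
Proof.
split=> [|x y|x y].
- exact/val_ge0P/val_ge0_1.
- by move=> /val_ge0P hx /val_ge0P hy; apply/val_ge0P/val_ge0_sub.
- by move=> /val_ge0P hx /val_ge0P hy; apply/val_ge0P/val_ge0_mul.
Qed.

End Valuation.

HB.instance Definition _ (K : fieldType) (v : K -> int)
    (hv : normalized_valuation v) :=
  GRing.isSubringClosed.Build K (valuation_ring hv) (valuation_ring_subring hv).

(** [integralOver] is relative to a ring morphism, so the valuation ring is needed as a ring
    type. *)
Record val_int (K : fieldType) (v : K -> int) (hv : normalized_valuation v) :=
  ValInt { val_int_val : K; _ : val_int_val \in valuation_ring hv }.

HB.instance Definition _ K v hv := [isSub for @val_int_val K v hv].
HB.instance Definition _ K v hv := [Choice of @val_int K v hv by <:].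
HB.instance Definition _ K v hv := [SubChoice_isSubComNzRing of @val_int K v hv by <:].

Definition val_int_alg (K : fieldType) (v : K -> int)
    (hv : normalized_valuation v) (L : fieldExtType K) : {rmorphism val_int hv -> L} :=
  in_alg L \o \val.

(** * Elements integral over a valuation ring *)

Section Integral.

Variables (K : fieldType) (v : K -> int) (hv : normalized_valuation v).
Variable L : fieldExtType K.
Implicit Types (x y : L) (a : K).

Definition vintegral x := integralOver (val_int_alg hv L) x.

Lemma vintegral1 : vintegral 1. Proof. exact: integral1. Qed.
Lemma vintegral0 : vintegral 0. Proof. exact: integral0. Qed.
Lemma vintegralD x y : vintegral x -> vintegral y -> vintegral (x + y).
Proof. exact: integral_add. Qed.
Lemma vintegralB x y : vintegral x -> vintegral y -> vintegral (x - y).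
Proof. exact: integral_sub. Qed.
Lemma vintegralN x : vintegral x -> vintegral (- x).
Proof. exact: integral_opp. Qed.
Lemma vintegralM x y : vintegral x -> vintegral y -> vintegral (x * y).
Proof. exact: integral_mul. Qed.
Lemma vintegralX x n : vintegral x -> vintegral (x ^+ n).
Proof.
move=> hx; elim: n => [|n IH]; first by rewrite expr0; apply: vintegral1.
by rewrite exprS; apply: vintegralM.
Qed.
Lemma vintegral_nat n : vintegral n%:R. Proof. exact: integral_nat. Qed.

Lemma vintegral_sum (I : Type) (r : seq I) (P : pred I) (F : I -> L) :
  (forall i, P i -> vintegral (F i)) -> vintegral (\sum_(i <- r | P i) F i).
Proof. by apply: big_ind; [apply: vintegral0|apply: vintegralD]. Qed.

Lemma vintegral_prod (I : Type) (r : seq I) (P : pred I) (F : I -> L) :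
  (forall i, P i -> vintegral (F i)) -> vintegral (\prod_(i <- r | P i) F i).
Proof. by apply: big_ind; [apply: vintegral1|apply: vintegralM]. Qed.

Lemma vintegral_root_monic (p : {poly L}) x :
  p \is monic -> root p x -> (forall i, vintegral p`_i) -> vintegral x.
Proof.
move=> pm px hp; apply: (integral_root_monic pm px).
by apply/(integral_poly (val_int_alg hv L)).
Qed.

Lemma vintegral_horner (p : {poly L}) x :
  (forall i, vintegral p`_i) -> vintegral x -> vintegral p.[x].
Proof.
by move=> hp; apply: integral_horner; apply/(integral_poly (val_int_alg hv L)).
Qed.

(** By transitivity of integrality, since [x] is a root of ['X^n - x^n]. *)
Lemma vintegral_expr x n : (0 < n)%N -> vintegral (x ^+ n) -> vintegral x.
Proof.
move=> n0 hx; apply: (@vintegral_root_monic ('X^n - (x ^+ n)%:P)).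
- exact: monicXnsubC.
- by rewrite rootE !hornerE subrr.
- move=> i; rewrite coefB coefXn coefC.
  by apply: vintegralB; [apply: vintegral_nat|case: (i == 0)%N => //; apply: vintegral0].
Qed.

Lemma vintegral_ge0 a : val_ge0 v a -> vintegral a%:A.
Proof.
by move=> /val_ge0P ha; apply: (integral_id (val_int_alg hv L) (@ValInt _ _ hv a ha)).
Qed.

(* Valuation rings are integrally closed: if [v a < 0], dividing an
   integral equation by a power of [a] exhibits [a] as a polynomial in [a^-1]. *)
Lemma vintegral_base a : vintegral a%:A -> val_ge0 v a.
Proof.
move=> [p pm pa]; have {pa} : root (map_poly val p) a.
  by rewrite -(fmorph_root (in_alg L)) -map_poly_comp.
set q := map_poly val p => qa.
have hq i : val_ge0 v q`_i by apply/val_ge0P; rewrite coef_map; apply: (valP p`_i).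
have qm : q \is monic by apply: monic_map.
have [->|a0] := eqVneq a 0; first by left.
have [|va] := leP 0 (v a); first by right.
have hb : val_ge0 v a^-1 by right; rewrite val_inv // oppr_ge0 ltW.
have hbX n : val_ge0 v (a^-1 ^+ n).
  by elim: n => [|n IH]; [rewrite expr0; apply: val_ge0_1|rewrite exprS; apply: val_ge0_mul].
have sq : (size q).-1.+1 = size q by rewrite prednK // size_poly_gt0 monic_neq0.
(* The only monic constant is [1], which has no root. *)
have sq1 : (0 < (size q).-1)%N.
  case: (size q).-1 sq (qm) => // /esym/eqP /size_poly1P [k _ qk].
  rewrite qk monicE lead_coefC => /eqP k1; move: qa.
  by rewrite qk k1 rootC oner_eq0.
have: q.[a] = 0 by apply/rootP.
rewrite horner_coef -sq big_ord_recr /=.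
have -> : q`_(size q).-1 = 1 by apply/eqP.
rewrite mul1r => h.
have -> : a = \sum_(i < (size q).-1) (0 - q`_i) * a^-1 ^+ ((size q).-1.-1 - i).
  apply: (mulIf (expf_neq0 (size q).-1.-1 a0)); rewrite -exprS prednK // mulr_suml.
  apply/eqP; rewrite -subr_eq0 -[X in _ == X]h [X in _ == X]addrC; apply/eqP; congr (_ + _).
  rewrite -sumrN; apply: eq_bigr => i _; rewrite sub0r mulNr mulNr opprK -mulrA.
  congr (_ * _); have hi : (i <= (size q).-1.-1)%N by rewrite -ltnS prednK.
  rewrite -[X in a ^+ X](subnK hi) exprD mulrA exprVn mulVf ?mul1r //.
  exact: expf_neq0.
elim/big_ind: _ => [|x y hx hy|i _]; first by left.
- have -> : x + y = x - (0 - y) by rewrite sub0r opprK.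
  by apply: val_ge0_sub => //; apply: val_ge0_sub => //; left.
- by apply: val_ge0_mul => //; apply: val_ge0_sub => //; left.
Qed.

Lemma vintegral_aut (f : 'AEnd(L)) x : vintegral x -> vintegral (f x).
Proof.
move=> [p pm px]; exists p => //.
have -> : map_poly (val_int_alg hv L) p = map_poly f (map_poly (val_int_alg hv L) p).
  rewrite -map_poly_comp; apply: eq_map_poly => a /=.
  by rewrite linearZ /= rmorph1.
by rewrite fmorph_root.
Qed.

End Integral.

(** * Unramified extensions *)

(** The product rule: as [r] has no repetitions, the condition [b' != b] removes exactly one
    factor. *)
Lemma deriv_prod_XsubC (R : comNzRingType) (r : seq R) x : uniq r ->
  (\prod_(b <- r) ('X - b%:P))^`().[x] =
  \sum_(b <- r) \prod_(b' <- r | b' != b) (x - b').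
Proof.
elim: r => [|b r IH] /=; first by rewrite !big_nil derivC hornerC.
move=> /andP[br ur]; rewrite !big_cons derivM derivXsubC mul1r.
rewrite hornerD hornerM hornerXsubC IH // horner_prod eqxx /=; congr (_ + _).
  rewrite [LHS]big_seq [RHS]big_seq_cond; apply: eq_big => [y|y _].
    by case yr: (y \in r) => //=; apply/esym; apply: contraNneq br => <-.
  by rewrite hornerXsubC.
rewrite mulr_sumr [LHS]big_seq [RHS]big_seq; apply: eq_bigr => y yr.
rewrite big_cons; case: eqVneq => // e; by rewrite e yr in br.
Qed.

Section Unramified.

Variables (K : fieldType) (v : K -> int) (hv : normalized_valuation v).
Variables (L : splittingFieldType K) (F : {subfield L}) (bs : seq L).
Hypothesis galF : galois 1 F.
Hypothesis genF : <<1 & bs>>%VS = F.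
Hypothesis bs_int : {in bs, forall b, vintegral hv b}.
Hypothesis bs_unit : {in bs &, forall b b', b != b' -> vintegral hv (b - b')^-1}.
Hypothesis bs_gal : forall s : gal_of F, {in bs, forall b, s b \in bs}.
Variable pi : K.
Hypothesis pi1 : v pi = 1.
Hypothesis pi0 : pi != 0.

Local Notation int := (vintegral hv).
Local Notation "a %:L" := (a%:A : L) (at level 2).

Lemma mem_gen_roots b : b \in bs -> b \in F.
Proof. by move=> hb; rewrite -genF seqv_sub_adjoin. Qed.

(* The functions [s |-> \sum x_k * s y_k] with [x_k], [y_k] integral; they form a ring. *)
Definition tensor_fun (phi : gal_of F -> L) : Prop :=
  exists2 xy : seq (L * L),
    {in xy, forall p, [/\ int p.1, int p.2 & p.2 \in F]} &
    forall s, phi s = \sum_(p <- xy) p.1 * s p.2.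

Lemma tensor_fun_mul phi psi :
  tensor_fun phi -> tensor_fun psi -> tensor_fun (fun s => phi s * psi s).
Proof.
move=> [xs hx ex] [ys hy ey].
exists [seq (p.1 * q.1, p.2 * q.2) | p <- xs, q <- ys].
  move=> _ /allpairsP[[p q] /= [/hx[p1 p2 pF] /hy[q1 q2 qF] ->]] /=.
  by split; [apply: vintegralM|apply: vintegralM|apply: memvM].
move=> s; rewrite ex ey big_allpairs_dep mulr_suml; apply: eq_bigr => p _.
rewrite mulr_sumr; apply: eq_bigr => q _ /=.
by rewrite rmorphM /= mulrACA.
Qed.

Lemma tensor_fun_prod (I : Type) (r : seq I) (P : pred I) (phi : I -> gal_of F -> L) :
  (forall i, P i -> tensor_fun (phi i)) ->
  tensor_fun (fun s => \prod_(i <- r | P i) phi i s).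
Proof.
move=> h; elim: r => [|i r [xy hxy exy]].
  exists [:: (1, 1)] => [p|s].
    by rewrite inE => /eqP ->; split; [apply: vintegral1|apply: vintegral1|apply: mem1v].
  by rewrite big_nil big_seq1 /= rmorph1 mulr1.
have hr : tensor_fun (fun s => \prod_(i <- r | P i) phi i s) by exists xy.
case Pi: (P i); last by exists xy => // s; rewrite big_cons Pi.
by have [z hz ez] := tensor_fun_mul (h _ Pi) hr; exists z => // s; rewrite big_cons Pi.
Qed.

(** For [t != 1] choose a root [b] moved by [t]. The function [s |-> (t b - s b) / (t b - b)]
    vanishes at [t], is [1] at the identity, and has integral coefficients because differences of
    roots are units. The product over all [t != 1] is the indicator of the identity. *)
Lemma tensor_fun_delta : tensor_fun (fun s => (s == 1%g)%:R).
Proof.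
(* An automorphism fixing every root is trivial, since the roots generate [F]. *)
have mv (t : gal_of F) : t != 1%g -> exists2 b, b \in bs & t b != b.
  move=> t1; apply/hasP; apply: contraNT t1 => /hasPn h; apply/eqP.
  have: t \in 'Gal(F / F)%g.
    have : (F <= fixedField [set t])%VS.
      rewrite -[X in (X <= _)%VS]genF; apply/Fadjoin_seqP; split; first exact: sub1v.
      move=> b hb; apply/fixedFieldP; first exact: mem_gen_roots.
      by move=> x; rewrite inE => /eqP ->; apply/eqP; move: (h b hb); rewrite negbK.
    by rewrite -galois_connection // sub1set.
  rewrite gal_kHom // => /kAHomP ht; apply/eqP/gal_eqP => a ha.
  by rewrite gal_id ht.
pose phi (t : gal_of F) : gal_of F -> L :=
  if pickP (fun i : 'I_(size bs) => t bs`_i != bs`_i) is Pick i _ then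
    fun s => (t bs`_i - bs`_i)^-1 * (t bs`_i - s bs`_i) else fun=> 1.
have phiP t : t != 1%g -> [/\ tensor_fun (phi t), phi t t = 0 & phi t 1%g = 1].
  move=> /mv [b hb tb]; rewrite /phi; case: pickP => [i ti|]; last first.
    move/(_ (Ordinal (etrans (index_mem _ _) hb))) => /=.
    by rewrite nth_index // tb.
  have bi : bs`_i \in bs by rewrite mem_nth.
  set b0 := bs`_i in ti bi *; split; first 1 last.
  - by rewrite subrr mulr0.
  - by rewrite gal_id mulVf // subr_eq0.
  have hu : int (t b0 - b0)^-1 by apply: bs_unit => //; apply: bs_gal.
  exists [:: ((t b0 - b0)^-1 * t b0, 1); (- (t b0 - b0)^-1, b0)].
    move=> p; rewrite !inE => /orP[]/eqP -> /=; split.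
    - by apply: vintegralM => //; apply/bs_int/bs_gal.
    - exact: vintegral1.
    - exact: mem1v.
    - exact: vintegralN.
    - exact: bs_int.
    - exact: mem_gen_roots.
  by move=> s; rewrite big_cons big_seq1 /= rmorph1 mulr1 mulrBr mulNr.
have [xy hxy exy] : tensor_fun (fun s => \prod_(t : gal_of F | t != 1%g) phi t s).
  by apply: tensor_fun_prod => t /phiP[].
exists xy => // s; rewrite -exy.
have [->|s1] := eqVneq s 1%g; first by rewrite big1 // => t /phiP[].
by rewrite (bigD1 s) //=; have [_ -> _] := phiP s s1; rewrite mul0r.
Qed.

(** The radical of the ideal generated by [pi] in the ring of integral elements. *)
Definition val_nilpotent (x : L) : Prop :=
  int x /\ exists m, int (x ^+ m * pi^-1%:L).

(** In the binomial expansion of [(x + y)^(m + n)] each term contains [x^m] or [y^n]. *)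
Lemma val_nilpotentD x y :
  val_nilpotent x -> val_nilpotent y -> val_nilpotent (x + y).
Proof.
move=> [hx [m hm]] [hy [n hn]]; split; first exact: vintegralD.
exists (m + n)%N; rewrite exprDn mulr_suml; apply: vintegral_sum => i _.
rewrite -mulr_natr -[X in int X]mulrA [_%:R * _]mulrC mulrA.
apply: vintegralM (vintegral_nat _ _ _).
have [ni|ni] := leqP n i.
  rewrite -mulrA; apply: vintegralM; first exact: vintegralX.
  by rewrite -(subnK ni) exprD -mulrA; apply: vintegralM => //; apply: vintegralX.
have mi : (m <= m + n - i)%N.
  by rewrite leq_subRL; [rewrite addnC leq_add2l ltnW | rewrite ltnW // ltn_addl].
rewrite mulrAC; apply: vintegralM; last exact: vintegralX.
by rewrite -(subnK mi) exprD -mulrA; apply: vintegralM => //; apply: vintegralX.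
Qed.

Lemma val_nilpotentM x y : int x -> val_nilpotent y -> val_nilpotent (x * y).
Proof.
move=> hx [hy [m hm]]; split; first exact: vintegralM.
by exists m; rewrite exprMn -mulrA; apply: vintegralM => //; apply: vintegralX.
Qed.

Lemma val_nilpotent_aut (s : 'AEnd(L)) x : val_nilpotent x -> val_nilpotent (s x).
Proof.
move=> [hx [m hm]]; split; first exact: vintegral_aut.
exists m; have := vintegral_aut s hm; rewrite rmorphM rmorphXn /=.
by rewrite linearZ /= rmorph1.
Qed.

(** Values are integers: [v a *+ m >= 1] forces [v a >= 1 = v pi]. *)
Lemma val_nilpotent_base (a : K) : val_nilpotent a%:L -> val_ge0 v (a / pi).
Proof.
move=> [_ [m]]; have -> : a%:L ^+ m * pi^-1%:L = (a ^+ m / pi)%:A.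
  by rewrite -(rmorphXn (in_alg L)) -(rmorphM (in_alg L)).
move/vintegral_base; have [->|a0] := eqVneq a 0; first by rewrite mul0r; left.
move=> [/eqP|].
  by rewrite mulf_eq0 invr_eq0 (negPf pi0) orbF expf_eq0 (negPf a0) andbF.
rewrite (Defs.valM hv) ?expf_neq0 ?invr_eq0 // (val_exp hv) // (val_inv hv) // pi1.
rewrite subr_ge0 => h; right; rewrite (Defs.valM hv) ?invr_eq0 // (val_inv hv) // pi1.
rewrite subr_ge0; have : 0 < v a *+ m by apply: lt_le_trans h.
by case: m {h} => [|m]; rewrite ?mulr0n ?ltxx // pmulrn_lgt0.
Qed.

(* Reducedness modulo [pi]: the trace form expresses [f] through the
   traces of [y_k * f], which are elements of [K] nilpotent modulo [pi]. *)
Lemma vintegral_div_pi f m : f \in F -> (0 < m)%N ->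
  int (f ^+ m * pi^-1%:L) -> int (f * pi^-1%:L).
Proof.
move=> fF m0 hm.
have fi : int f.
  apply: (vintegral_expr m0).
  have -> : f ^+ m = f ^+ m * pi^-1%:L * pi%:L.
    by rewrite -mulrA -(rmorphM (in_alg L)) mulVf // rmorph1 mulr1.
  by apply: vintegralM => //; apply: vintegral_ge0; right; rewrite pi1.
have fn : val_nilpotent f by split=> //; exists m.
have [xy hxy exy] := tensor_fun_delta.
(* Exchanging the two sums gives the sum over [s] of [s f] weighted by the indicator of the
   identity, and only [f] survives. *)
have -> : f = \sum_(p <- xy) p.1 * galTrace 1 F (p.2 * f).
  rewrite /galTrace; under eq_bigr do rewrite mulr_sumr.
  rewrite exchange_big /= (bigD1 (1%g : gal_of F)) ?group1 //=.
  rewrite [X in _ + X]big1 ?addr0 => [|s /andP[_ s1]].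
    under eq_bigr do rewrite rmorphM mulrA.
    by rewrite -mulr_suml -exy eqxx mul1r /= gal_id.
  under eq_bigr do rewrite rmorphM mulrA.
  by rewrite -mulr_suml -exy (negPf s1) mul0r.
rewrite mulr_suml big_seq; apply: vintegral_sum => p /hxy[p1 p2 pF].
(* The trace lies in [K] and is a sum of conjugates of [p.2 * f], hence nilpotent modulo [pi]; in
   [K] this means divisible by [pi]. *)
have /(mem_galTrace galF) /vlineP[k hk] : p.2 * f \in F by rewrite memvM.
rewrite hk -mulrA -(rmorphM (in_alg L)); apply: vintegralM => //.
apply: vintegral_ge0; apply: val_nilpotent_base; rewrite -hk.
rewrite /galTrace; elim/big_ind: _ => [|x y|s _].
- by split; [apply: vintegral0|exists 1%N; rewrite mul0r; apply: vintegral0].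
- exact: val_nilpotentD.
- by apply: val_nilpotent_aut; apply: val_nilpotentM.
Qed.

(** * Independence of the [b - c] modulo [d]-th powers *)

Variable c : K.
Hypothesis uniq_bs : uniq bs.

(** These are the [B_i] of the overview, indexed by the roots themselves. *)
Definition cofactor_at b := \prod_(b' <- bs | b' != b) (b' - c%:L).

(** [s] fixes [c] and permutes [bs], as an injective map of a finite set to itself. *)
Lemma cofactor_at_gal (s : gal_of F) b : b \in bs ->
  s (cofactor_at b) = cofactor_at (s b).
Proof.
move=> hb; rewrite /cofactor_at rmorph_prod /=.
have sb : perm_eq (map s bs) bs.
  apply: uniq_perm => //; first by rewrite map_inj_uniq //; apply: fmorph_inj.
  apply: (uniq_min_size _ _ _).2; rewrite ?size_map //.
    by rewrite map_inj_uniq //; apply: fmorph_inj.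
  by move=> _ /mapP[x hx ->]; apply: bs_gal.
rewrite -[RHS](perm_big _ sb) big_map /=; apply: eq_big => x.
  by rewrite (inj_eq (fmorph_inj _)).
by move=> _; rewrite rmorphB /= linearZ /= rmorph1.
Qed.

Hypothesis c_ge0 : val_ge0 v c.
Hypothesis bs_trans : {in bs &, forall b b', exists s : gal_of F, s b = b'}.
Variable g : {poly K}.
Hypothesis g_bs : map_poly (in_alg L) g = \prod_(b <- bs) ('X - b%:P).
Hypothesis gc_deriv : g^`().[c] != 0 /\ v g^`().[c] = 0.

Lemma bsc_int b : b \in bs -> int (b - c%:L).
Proof. by move=> hb; apply: vintegralB; [apply: bs_int|apply: vintegral_ge0]. Qed.

Lemma cofactor_at_int b : int (cofactor_at b).
Proof.
rewrite /cofactor_at big_seq_cond; apply: vintegral_prod => b' /andP[hb _].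
exact: bsc_int.
Qed.

Lemma bsc_F b : b \in bs -> b - c%:L \in F.
Proof.
by move=> hb; apply: memvB; [apply: mem_gen_roots|apply: memvZ; apply: mem1v].
Qed.

Lemma cofactor_at_F b : cofactor_at b \in F.
Proof.
rewrite /cofactor_at big_seq_cond.
by apply: rpred_prod => b' /andP[hb _]; apply: bsc_F.
Qed.

(* The cofactors are conjugate and, up to sign, add up to the unit [g'(c)]. *)
Lemma cofactor_not_div_pi b : b \in bs -> ~ int (cofactor_at b * pi^-1%:L).
Proof.
move=> hb hB.
have hBs b' : b' \in bs -> int (cofactor_at b' * pi^-1%:L).
  move=> hb'; have [s <-] := bs_trans hb hb'.
  have := vintegral_aut s hB; rewrite rmorphM /= cofactor_at_gal //.
  by rewrite linearZ /= rmorph1.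
have [d0 dv] := gc_deriv.
have : int (g^`().[c]%:L * pi^-1%:L).
  have -> : g^`().[c]%:L = (map_poly (in_alg L) g)^`().[c%:L].
    by rewrite deriv_map (horner_map (in_alg L)).
  rewrite g_bs deriv_prod_XsubC // mulr_suml big_seq; apply: vintegral_sum => b' hb'.
  have -> : \prod_(b0 <- bs | b0 != b') (c%:L - b0) =
      \prod_(b0 <- bs | b0 != b') (-1) * cofactor_at b'.
    by rewrite -big_split /=; apply: eq_bigr => x _; rewrite mulN1r opprB.
  rewrite -mulrA; apply: vintegralM (hBs _ hb').
  by apply: vintegral_prod => i _; apply: vintegralN; apply: vintegral1.
rewrite -(rmorphM (in_alg L)) => /vintegral_base [/eqP|].
  by rewrite mulf_eq0 invr_eq0 (negPf pi0) (negPf d0).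
by rewrite (Defs.valM hv) ?invr_eq0 // (val_inv hv) // pi1 dv.
Qed.

Variables (a d : nat).
Hypothesis gc_val : g.[c] != 0 /\ v g.[c] = a%:Z.
Hypothesis ad_coprime : coprime a d.
Hypothesis d_gt0 : (0 < d)%N.

(** If [d] does not divide [e b], then [a * e b = m * d + r] with [0 < r < d]. The element
    [t = y * B^(e b)] satisfies [t^d = eps^(e b) * W], where [eps] has valuation [a] and [W] divides
    a power of the cofactor [B] of [b]. By reducedness [t / pi^m] is divisible by [pi], since its
    [d]-th power is; comparing [d]-th powers, [pi] divides [W]. So [pi] divides a power of [B],
    hence [B] itself, which is impossible. *)
Lemma pow_indep (e : L -> nat) (y : L) : y \in F ->
  y ^+ d = \prod_(b <- bs) (b - c%:L) ^+ e b -> {in bs, forall b, (d %| e b)%N}.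
Proof.
move=> yF yd b hb.
(* Up to sign the product of the [b - c] is [g(c)]. *)
have [eps [eps0 epsv epsE]] :
    exists eps : K, [/\ eps != 0, v eps = a%:Z & \prod_(b <- bs) (b - c%:L) = eps%:L].
  have [g0 gv] := gc_val; exists ((-1) ^+ size bs * g.[c]).
  split.
  - by rewrite mulf_eq0 negb_or signr_eq0.
  - rewrite -signr_odd; case: odd; last by rewrite expr0 mul1r.
    by rewrite expr1 mulN1r val_opp.
  - rewrite [RHS](rmorphM (in_alg L)) rmorphXn rmorphN1 -(horner_map (in_alg L)) g_bs.
    have -> : (-1) ^+ size bs = \prod_(b <- bs) (-1 : L).
      by elim: (bs) => [|x s IH]; rewrite ?big_nil // big_cons -IH exprS.
    rewrite horner_prod.
    by rewrite -big_split /=; apply: eq_bigr => x _; rewrite hornerXsubC mulN1r opprB.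
pose B := cofactor_at b.
have bB : (b - c%:L) * B = eps%:L by rewrite -epsE (bigD1_seq b).
pose W := \prod_(b' <- bs | b' != b) (b' - c%:L) ^+ e b' * B ^+ (e b * d.-1).
pose t := y * B ^+ e b.
have tF : t \in F by rewrite memvM // rpredX // cofactor_at_F.
have td : t ^+ d = (eps ^+ e b)%:L * W.
  rewrite exprMn yd (bigD1_seq b) //= (_ : (eps ^+ e b)%:L = eps%:L ^+ e b); last exact: (rmorphXn (in_alg L)).
  rewrite -bB exprMn /W.
  rewrite -exprM (_ : (e b * d = e b + e b * d.-1)%N) ?exprD; last by rewrite -mulnS prednK.
  by rewrite -!mulrA; congr (_ * _); rewrite mulrCA.
(* Each [b' - c] with [b' != b] is a factor of [B], and the divisors of powers of [B] are closed
   under products and powers. *)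
have [M [W' [W'i WW']]] : exists M W', int W' /\ W * W' = B ^+ M.
  pose D x := exists M W', int W' /\ x * W' = B ^+ M.
  have D1 : D 1 by exists 0%N, 1; rewrite mulr1 expr0; split=> //; apply: vintegral1.
  have DM x z : D x -> D z -> D (x * z).
    move=> [m [x' [xi xx]]] [n [z' [zi zz]]]; exists (m + n)%N, (x' * z').
    by split; [apply: vintegralM | rewrite mulrACA xx zz exprD].
  have DX x n : D x -> D (x ^+ n).
    by move=> hx; elim: n => [|n IH]; rewrite ?expr0 // exprS; apply: DM.
  apply: (DM); last first.
    by apply: (DX); exists 1%N, 1; rewrite mulr1 expr1; split=> //; apply: vintegral1.
  rewrite big_seq_cond; elim/big_ind: _ => [//||b' /andP[hb' bb']]; first exact: DM.
  apply: DX.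
  exists 1%N, (\prod_(x <- bs | (x != b) && (x != b')) (x - c%:L)); split.
    rewrite big_seq_cond; apply: vintegral_prod => x /andP[hx _]; exact: bsc_int.
  rewrite expr1 /B /cofactor_at -[RHS]big_filter (bigD1_seq b') ?filter_uniq //=.
    by rewrite big_filter_cond.
  by rewrite mem_filter bb'.
have valpi k : v (pi ^+ k) = k%:Z by rewrite (val_exp hv) // pi1 natz.
have valeps k : v (eps ^+ k) = (a * k)%N%:Z by rewrite (val_exp hv) // epsv -mulr_natr natz -PoszM.
have piX k : pi ^+ k != 0 by rewrite expf_neq0.
have epsX k : eps ^+ k != 0 by rewrite expf_neq0.
have [r0|r0] := posnP (a * e b %% d).
  by move/eqP: r0; rewrite -/(dvdn _ _) Gauss_dvdr // coprime_sym.
case: (@cofactor_not_div_pi b) => //.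
set m := (a * e b %/ d)%N; set r := (a * e b %% d)%N in r0.
have aE : (a * e b)%N = (m * d + r)%N by apply: divn_eq.
have rd : (r < d)%N by rewrite ltn_mod.
pose t' := t * (pi ^+ m)^-1%:L.
have t'F : t' \in F by apply: memvM => //; apply: memvZ; apply: mem1v.
have t'd : t' ^+ d = (eps ^+ e b / pi ^+ (m * d))%:L * W.
  by rewrite exprMn td -(rmorphXn (in_alg L)) exprVn -exprM mulrAC -(rmorphM (in_alg L)).
(* In [t'^d] the scalar factor has valuation [r], and [r > 0]. *)
have : int (t' * pi^-1%:L).
  apply: (vintegral_div_pi t'F d_gt0).
  rewrite t'd mulrAC -(rmorphM (in_alg L)); apply: vintegralM.
    apply: vintegral_ge0; right; rewrite -mulrA -invfM -exprSr.
    by rewrite (Defs.valM hv) ?invr_eq0 // (val_inv hv) // valeps valpi subr_ge0 lez_nat aE -addn1 leq_add2l.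
  rewrite /W; apply: vintegralM; last by apply/vintegralX/cofactor_at_int.
  by rewrite big_seq_cond; apply: vintegral_prod => b' /andP[hb' _]; apply/vintegralX/bsc_int.
move/(vintegralX d); rewrite exprMn t'd => hW.
(* Now [pi^d] divides [t'^d], while the scalar in front of [W] accounts for only [r <= d - 1]
   factors [pi]. *)
have Wpi : int (W * pi^-1%:L).
  have -> : W * pi^-1%:L = (eps ^+ e b / pi ^+ (m * d))%:L * W * pi^-1%:L ^+ d *
     (pi ^+ (m * d + d.-1) / eps ^+ e b)%:L.
    move: (W) => w; rewrite -(rmorphXn (in_alg L)) [_ * w]mulrC -!mulrA; congr (_ * _).
    rewrite -!(rmorphM (in_alg L)) /=; congr (_ *: 1).
    rewrite exprVn -[in pi ^+ d](prednK d_gt0) exprS exprD.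
    have := epsX (e b); have := piX (m * d)%N; have := piX d.-1; move: (pi0).
    move: (pi ^+ d.-1) (pi ^+ (m * d)) (eps ^+ e b) => p1 p2 p3 q0 q1 q2 q3.
    by field; rewrite q0 q1 q2 q3.
  apply: vintegralM => //; apply: vintegral_ge0; right.
  rewrite (Defs.valM hv) ?invr_eq0 // (val_inv hv) // valeps valpi subr_ge0 lez_nat aE.
  by rewrite leq_add2l -ltnS prednK.
(* The exponent must be positive and [M] may be [0], hence one more factor [B]. *)
apply: (@vintegral_div_pi _ M.+1) => //; first exact: cofactor_at_F.
rewrite exprSr -WW' mulrAC; apply: vintegralM; last exact: cofactor_at_int.
by rewrite mulrAC; apply: vintegralM.
Qed.

End Unramified.

(** * Kummer theory *)

Section Kummer.

Variables (K : fieldType) (L : splittingFieldType K) (F E : {subfield L}).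
Hypothesis galEF : galois F E.

(* Dedekind's argument for eigenvectors of [Gal(E/F)] with pairwise distinct characters. *)
Lemma eigenvectors_free (T : finType) (M a : T -> L) :
  (forall t, M t \in E) -> (forall t, M t != 0) ->
  (forall (s : gal_of E) t, s \in 'Gal(E / F)%g -> s (M t) / M t \in F) ->
  (forall t t', t != t' -> M t / M t' \notin F) ->
  (forall t, a t \in F) -> \sum_t a t * M t = 0 -> forall t, a t = 0.
Proof.
move=> ME M0 Mchi Mneq; have sFE : (F <= E)%VS by case/and3P: galEF.
(* Induction on the number of nonzero coefficients. *)
have [n] := ubnP #|[pred t | a t != 0]|; elim: n a => // n IH a lea aF rel t0.
apply/eqP; apply/negPn/negP => a0.
have [t1 /andP[a1 t10]|only] := pickP (fun t => (a t != 0) && (t != t0)); last first.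
  move: rel; rewrite (bigD1 t0) //= big1 ?addr0 => [/eqP|t tt0].
    by rewrite mulf_eq0 (negPf a0) (negPf (M0 _)).
  by move: (only t); rewrite tt0 andbT => /negbFE/eqP ->; rewrite mul0r.
(* A ratio fixed by the whole Galois group would lie in [F]. *)
have [s sG sM] : exists2 s : gal_of E, s \in 'Gal(E / F)%g &
    s (M t1 / M t0) != M t1 / M t0.
  apply/exists_inP; apply: contraNT (Mneq _ _ t10).
  rewrite negb_exists_in => /forall_inP h.
  rewrite -(galois_fixedField galEF); apply/fixedFieldP.
    by rewrite memvM ?memvV.
  by move=> s sG; apply/eqP; move: (h s sG); rewrite negbK.
pose chi t := s (M t) / M t.
(* Applying [s] to the relation and subtracting [chi t0] times the relation removes the term of
   [t0]. The shorter relation is trivial by induction, so [chi t1 = chi t0], against the choice of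
   [s]. *)
have : a t1 * (chi t1 - chi t0) = 0.
  apply: (IH (fun t => a t * (chi t - chi t0))).
  - rewrite ltnS in lea; apply: leq_trans lea; apply: proper_card; apply/properP; split.
      by apply/subsetP => t; rewrite !inE; apply: contraNneq => ->; rewrite mul0r.
    by exists t0; rewrite !inE ?a0 // subrr mulr0 eqxx.
  - by move=> t; apply: memvM => //; apply: memvB; apply: Mchi.
  - have : s (\sum_t a t * M t) - chi t0 * \sum_t a t * M t = 0.
      by rewrite rel rmorph0 mulr0 subrr.
    rewrite rmorph_sum mulr_sumr -sumrB => h; rewrite -[RHS]h; apply: eq_bigr => t _.
    rewrite rmorphM /= (fixed_gal sFE sG) //.
    have -> : s (M t) = chi t * M t by rewrite /chi mulfVK.
    by move: (chi t) (chi t0) => x y; ring.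
move/eqP; rewrite mulf_eq0 (negPf a1) subr_eq0 /= => /eqP chi10.
case/eqP: sM; rewrite fmorph_div /=.
have sMt t : s (M t) = chi t * M t by rewrite /chi mulfVK.
rewrite !sMt chi10 -mulf_div divff ?mul1r //.
by rewrite /chi mulf_neq0 ?invr_eq0 // fmorph_eq0.
Qed.

(** * Extensions generated by [d]-th roots *)

Variables (I : finType) (r : I -> L) (d : nat) (z : L).
Hypothesis d_gt0 : (0 < d)%N.
Hypothesis z_prim : d.-primitive_root z.
Hypothesis zF : z \in F.
Hypothesis r0 : forall i, r i != 0.
Hypothesis rdF : forall i, r i ^+ d \in F.
Hypothesis genE : <<F & [seq r i | i <- enum I]>>%VS = E.
Hypothesis r_indep : forall (e : I -> nat) y, y \in F ->
  y ^+ d = \prod_i (r i ^+ d) ^+ e i -> forall i, (d %| e i)%N.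

(** The minimal polynomial of each new [x] divides ['X^d - x^d], so each adjunction has degree at
    most [d]. *)
Lemma dim_adjoin_radicals (rs : seq L) : {in rs, forall x, x ^+ d \in F} ->
  (\dim <<F & rs>> <= d ^ size rs * \dim F)%N.
Proof.
elim/last_ind: rs => [|rs x IH] h; first by rewrite Fadjoin_nil mul1n.
rewrite adjoin_rcons dim_Fadjoin size_rcons expnS -mulnA; apply: leq_mul; last first.
  by apply: IH => y hy; apply: h; rewrite mem_rcons inE hy orbT.
have xF : x ^+ d \in <<F & rs>>%VS.
  by apply: (subvP (subv_adjoin_seq _ _)); apply: h; rewrite mem_rcons mem_head.
rewrite -ltnS -size_minPoly -(size_XnsubC (x ^+ d) d_gt0); apply: dvdp_leq.
  by rewrite -size_poly_gt0 size_XnsubC.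
apply: minPoly_dvdp; last by rewrite rootE !hornerE subrr.
by rewrite rpredB ?rpredX ?polyOverX // polyOverC.
Qed.

(** The lower bound comes from the [d^#|I|] monomials in the [r i] with exponents below [d]: they
    are eigenvectors of the Galois group, and [r_indep] keeps their ratios out of [F], so they are
    free over [F]. *)
Theorem kummer_dim : \dim E = (d ^ #|I| * \dim F)%N.
Proof.
have sFE : (F <= E)%VS by case/and3P: galEF.
have rE i : r i \in E by rewrite -genE seqv_sub_adjoin // map_f ?mem_enum.
apply/eqP; rewrite eqn_leq; apply/andP; split.
  rewrite -[X in (\dim X <= _)%N]genE cardE -(size_map r).
  by apply: dim_adjoin_radicals => _ /mapP[i _ ->].
pose M (e : {ffun I -> 'I_d}) := \prod_i r i ^+ e i.
have ME e : M e \in E by apply: rpred_prod => i _; apply: rpredX.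
have M0 e : M e != 0 by apply/prodf_neq0 => i _; apply: expf_neq0.
have Mchi (s : gal_of E) e : s \in 'Gal(E / F)%g -> s (M e) / M e \in F.
  move=> sG; rewrite rmorph_prod -prodf_div; apply: rpred_prod => i _.
  rewrite rmorphXn -expr_div_n; apply: rpredX.
  have : (s (r i) / r i) ^+ d = 1.
    (* [s] fixes [r i ^+ d], so [s (r i) / r i] is a [d]-th root of unity, hence a power of [z]. *)
    by rewrite expr_div_n -rmorphXn /= (fixed_gal sFE sG) // divff // expf_neq0.
  by move/(prim_rootP z_prim) => [k ->]; apply: rpredX.
have Mneq e e' : e != e' -> M e / M e' \notin F.
  apply: contraNN => MF; apply/eqP/ffunP => i; apply: val_inj => /=.
  (* The factor [\prod_i r i ^+ d], which lies in [F], turns the exponents [e i - e' i] into the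
     natural numbers [e i + (d - e' i)]. *)
  have Mpow : (M e / M e' * \prod_i r i ^+ d) ^+ d =
      \prod_i (r i ^+ d) ^+ (e i + (d - e' i)).
    rewrite -prodf_div -big_split -prodrXl; apply: eq_bigr => j _ /=.
    rewrite -exprM mulnC exprM; congr (_ ^+ d).
    have le' : (e' j <= d)%N by apply: ltnW.
    rewrite exprD -[in r j ^+ d](subnK le') [in X in _ / _ * X]exprD.
    by rewrite mulrCA -!mulrA mulVf ?mulr1 1?mulrC // expf_neq0.
  have MF' : M e / M e' * \prod_i r i ^+ d \in F by rewrite memvM // rpred_prod.
  have /eqP dvde := r_indep MF' Mpow i.
  have le' : (e' i <= d)%N by apply: ltnW.
  rewrite -[LHS](modn_small (ltn_ord _)) -[RHS](modn_small (ltn_ord _)).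
  have ee : (e i + d = e i + (d - e' i) + e' i)%N by rewrite -addnA subnK.
  by rewrite -modnDr ee -modnDml dvde.
(* Freeness makes the spaces [F * <[M e]>] independent, and each has the dimension of [F]. *)
have dirM : directv (\sum_e (F * <[M e]>)).
  apply/directv_sum_independent => us usM us0.
  have /fin_all_exists2 [a aF ua] e : exists2 a, a \in F & us e = a * M e.
    by have /memv_cosetP := usM e isT.
  move=> e _; rewrite ua (eigenvectors_free ME M0 Mchi Mneq aF) ?mul0r //.
  by rewrite -[RHS]us0; apply: eq_bigr => e1 _; rewrite ua.
have := directvP dirM => /= dimM.
rewrite -{1}(card_ord d) -card_ffun -sum_nat_const.
under eq_bigr => e _ do rewrite -(dim_cosetv F (M0 e)).
rewrite -dimM; apply: dimvS; apply/subv_sumP => e _.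
by apply: prodv_sub => //; rewrite -memvE.
Qed.

End Kummer.

(** * Iterated unicritical polynomials *)

(** The head of [cs] is the outermost map. Passing to the next iterate is therefore [rcons], and
    inductions on [cs] run from the right. *)
Definition unicrit (K : fieldType) (d : nat) (cs : seq K) : {poly K} :=
  foldr (fun c p => ('X^d + c%:P) \Po p) 'X cs.

Section Unicritical.

Variables (K : fieldType) (d : nat).
Hypothesis d_gt1 : (1 < d)%N.
Implicit Types (c x : K) (cs : seq K).

Let d_gt0 : (0 < d)%N. Proof. exact: ltnW. Qed.

Lemma unicrit_rcons cs c :
  unicrit d (rcons cs c) = unicrit d cs \Po ('X^d + c%:P).
Proof.
elim: cs => [|c' cs IH] /=; first by rewrite comp_polyXr comp_polyX.
by rewrite IH comp_polyA.
Qed.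

Lemma size_unicrit cs : size (unicrit d cs) = (d ^ size cs).+1.
Proof.
elim/last_ind: cs => [|cs c IH]; first by rewrite size_polyX.
rewrite unicrit_rcons -[size (_ \Po _)]prednK; last first.
  by rewrite size_poly_gt0 comp_poly_eq0 ?size_XnaddC // -size_poly_gt0 IH.
by rewrite size_comp_poly IH size_XnaddC //= size_rcons expnSr.
Qed.

Lemma monic_unicrit cs : unicrit d cs \is monic.
Proof.
elim/last_ind: cs => [|cs c IH]; first exact: monicX.
rewrite unicrit_rcons monicE lead_coef_comp ?size_XnaddC //.
by rewrite (monicP IH) (lead_coefXnaddC c d_gt0) expr1n mulr1.
Qed.

Lemma deriv_unicrit_rcons cs c x :
  (unicrit d (rcons cs c))^`().[x] =
  (unicrit d cs)^`().[x ^+ d + c] * (d%:R * x ^+ d.-1).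
Proof.
rewrite unicrit_rcons deriv_comp hornerM horner_comp derivD derivXn derivC addr0.
by rewrite hornerD hornerC hornerXn hornerMn hornerXn mulr_natl.
Qed.

(** A proper factor [q] would give the proper factor [q(X^d + c)] of the next iterate. *)
Lemma irreducible_unicrit_rcons cs c :
  irreducible_poly (unicrit d (rcons cs c)) -> irreducible_poly (unicrit d cs).
Proof.
move=> [_ irr]; split; first by rewrite size_unicrit ltnS expn_gt0 d_gt0.
move=> q q1 qdvd.
have sq : (1 < size ('X^d + c%:P)%R)%N by rewrite size_XnaddC.
have q0 : q != 0.
  apply: contraTneq qdvd => ->; rewrite dvd0p.
  by rewrite -size_poly_eq0 size_unicrit.
have sqc : size (q \Po ('X^d + c%:P)) = ((size q).-1 * d)%N.+1.
  rewrite -[LHS]prednK ?size_comp_poly ?size_XnaddC //.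
  by rewrite size_poly_gt0 comp_poly_eq0.
have : q \Po ('X^d + c%:P) %= unicrit d (rcons cs c).
  apply: irr; last by rewrite unicrit_rcons; apply: dvdp_comp_poly.
  rewrite sqc eqSS muln_eq0 negb_or -lt0n -[d != 0]lt0n d_gt0 andbT.
  by rewrite -ltnS prednK ?size_poly_gt0 // ltn_neqAle eq_sym q1 size_poly_gt0.
move/eqp_size; rewrite sqc size_unicrit size_rcons expnSr => -[] /eqP.
rewrite eqn_pmul2r // => /eqP e; rewrite -dvdp_size_eqp // size_unicrit -e prednK //.
by rewrite size_poly_gt0.
Qed.

(** An irreducible polynomial with nonzero derivative is separable; here the derivative has leading
    coefficient [d^(size cs)], nonzero in [K]. *)
Lemma separable_unicrit cs : d%:R != 0 :> K ->
  irreducible_poly (unicrit d cs) -> separable_poly (unicrit d cs).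
Proof.
move=> dK irr; rewrite separable_poly.unlock; have [//|h] := boolP (coprimep _ _).
case: (irr) => s1 /(_ (gcdp (unicrit d cs) (unicrit d cs)^`())).
rewrite dvdp_gcdl => /(_ h isT) e.
have d0 : (unicrit d cs)^`() != 0.
  apply/eqP => /(congr1 (fun p : {poly K} => p`_(d ^ size cs).-1)).
  rewrite coef_deriv coef0 prednK ?expn_gt0 ?d_gt0 //.
  have := monicP (monic_unicrit cs); rewrite lead_coefE size_unicrit /= => -> /eqP.
  by rewrite natrX expf_eq0 (negPf dK) andbF.
have : unicrit d cs %| (unicrit d cs)^`() by rewrite -(eqp_dvdl _ e) dvdp_gcdr.
move/(dvdp_leq d0); rewrite leqNgt => /negP[]; apply: lt_size_deriv.
by rewrite monic_neq0 ?monic_unicrit.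
Qed.

Lemma polyOver_drop (S : subringClosed K) (p : {poly K}) : p \is a polyOver S ->
  exists2 q, q \is a polyOver S & p = q * 'X + p.[0]%:P.
Proof.
move=> pS; exists (drop_poly 1 p).
  by apply/polyOverP => i; rewrite coef_drop_poly; apply/polyOverP.
rewrite -{1}(poly_take_drop 1 p) expr1 addrC horner_coef0; congr (_ + _).
by apply/polyP => i; rewrite coef_take_poly coefC; case: i.
Qed.

(** * Iterates with coefficients in a valuation ring *)

Variables (v : K -> int) (hv : normalized_valuation v).
Hypothesis dv : d%:R != 0 :> K /\ v d%:R = 0.

Definition val_unit x := x != 0 /\ v x = 0.

Lemma val_unitM x y : val_unit x -> val_unit y -> val_unit (x * y).
Proof.
by move=> [x0 vx] [y0 vy]; split; [rewrite mulf_neq0|rewrite (Defs.valM hv) // vx vy].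
Qed.

Lemma val_unitX x n : val_unit x -> val_unit (x ^+ n).
Proof. by move=> [x0 vx]; split; [rewrite expf_neq0|rewrite (val_exp hv) // vx mul0rn]. Qed.

Lemma val_unit_ge0 x : val_unit x -> val_ge0 v x.
Proof. by move=> [_ e]; right; rewrite e. Qed.

Lemma val_unitV x : val_unit x -> val_unit x^-1.
Proof. by move=> [x0 vx]; split; [rewrite invr_eq0|rewrite (val_inv hv) // vx oppr0]. Qed.

Local Notation O := (valuation_ring hv).

Lemma unicrit_over cs : {in cs, forall c, val_ge0 v c} ->
  unicrit d cs \is a polyOver O.
Proof.
elim/last_ind: cs => [_|cs c IH h]; first exact: polyOverX.
rewrite unicrit_rcons polyOver_comp // ?IH // => [c' hc|].
  by apply: h; rewrite mem_rcons inE hc orbT.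
rewrite rpredD ?rpredX ?polyOverX // polyOverC.
by apply/val_ge0P; apply: h; rewrite mem_rcons mem_head.
Qed.

(* If [x] lay in the maximal ideal, [p.[0]] and [p.[x]] would be congruent modulo it. *)
Lemma val_unit_argument (p : {poly K}) x : p \is a polyOver O -> val_ge0 v x ->
  p.[x] != 0 -> 0 < v p.[x] -> val_unit p.[0] -> val_unit x.
Proof.
move=> pO hx p0 vp [u0 vu]; have [q qO pE] := polyOver_drop pO.
have qx : q.[x] \in O by apply: rpred_horner => //; apply/val_ge0P.
have x0 : x != 0.
  by apply: contraTneq vp => x0; rewrite x0 vu.
split=> //; case: hx => [/eqP|hx]; first by rewrite (negPf x0).
apply/eqP; rewrite eq_le hx andbT leNgt; apply/negP => vx.
have e : p.[0] = p.[x] - q.[x] * x by rewrite {2}pE !hornerE addrAC subrr add0r.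
have [q0|q0] := eqVneq q.[x] 0.
  by move: vp; rewrite q0 mul0r subr0 in e; rewrite -e vu.
have vq : 0 <= v q.[x] by move/val_ge0P: qx => -[/eqP|//]; rewrite (negPf q0).
have := Defs.valD hv p0 (_ : - (q.[x] * x) != 0); rewrite -e => /(_ _ u0).
rewrite oppr_eq0 mulf_neq0 // => /(_ isT); rewrite vu => hle.
have : 0 < Num.min (v p.[x]) (v (- (q.[x] * x))).
  by rewrite lt_min vp (val_opp hv) (Defs.valM hv) // ltr_wpDl.
by move/lt_le_trans/(_ hle); rewrite ltxx.
Qed.

(** By the chain rule the derivative is a product of factors [d] and of [(d-1)]-st powers of [x] and
    its successive images. Each such point is a unit by [val_unit_argument]: the remaining iterate
    is a unit at [0] but takes a value of positive valuation at the point. *)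
Lemma deriv_unicrit_unit cs x : {in cs, forall c, val_ge0 v c} -> val_ge0 v x ->
  (forall k, (0 < k <= size cs)%N -> val_unit (unicrit d (take k cs)).[0]) ->
  (unicrit d cs).[x] != 0 -> 0 < v (unicrit d cs).[x] ->
  val_unit (unicrit d cs)^`().[x].
Proof.
elim/last_ind: cs x => [|cs c IH] x hcs hx hu p0 vp.
  by rewrite derivX hornerC; split; [apply: oner_neq0|apply: val_one].
have hcs' : {in cs, forall c, val_ge0 v c}.
  by move=> c' hc; apply: hcs; rewrite mem_rcons inE hc orbT.
rewrite deriv_unicrit_rcons; apply: val_unitM.
  have e : (unicrit d cs).[x ^+ d + c] = (unicrit d (rcons cs c)).[x].
    by rewrite unicrit_rcons horner_comp !hornerE.
  apply: IH => //; rewrite ?e //.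
    have xcO : x ^+ d + c \in O.
      rewrite rpredD ?rpredX //; first exact/val_ge0P.
      by apply/val_ge0P; apply: hcs; rewrite mem_rcons mem_head.
    exact/val_ge0P.
  move=> k /andP[k0 ks]; have := hu k; rewrite size_rcons k0 leqW // => /(_ isT).
  by rewrite -cats1 takel_cat.
apply: val_unitM => //; apply: val_unitX.
apply: (@val_unit_argument (unicrit d (rcons cs c))) => //; first exact: unicrit_over.
by have := hu (size (rcons cs c)); rewrite take_size size_rcons leqnn; apply.
Qed.

(** * Roots of the iterates in an extension *)

Variable L : fieldExtType K.
Local Notation int := (vintegral hv).
Local Notation "p ^L" := (map_poly (in_alg L) p) (at level 2, format "p ^L").

Lemma vintegral_coef (p : {poly K}) i : p \is a polyOver O -> int (p^L)`_i.
Proof.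
move=> pO; rewrite coef_map; apply: vintegral_ge0; apply/val_ge0P.
exact: (polyOverP pO).
Qed.

(** Writing [p = q * 'X + p.[0]], the equation [p(b) = 0] gives [b^-1 = - q(b) / p(0)]. *)
Lemma root_unit (p : {poly K}) (b : L) : p \is a polyOver O -> p \is monic ->
  root p^L b -> val_unit p.[0] -> int b^-1.
Proof.
move=> pO pm pb pu; have [q qO pE] := polyOver_drop pO.
have bi : int b.
  by apply: (vintegral_root_monic _ pb) => [|i]; [apply: monic_map|apply: vintegral_coef].
have : b * (q^L).[b] = - (p.[0])%:A.
  move/rootP: pb; rewrite {1}pE rmorphD rmorphM /= map_polyX map_polyC !hornerE => /eqP.
  by rewrite addr_eq0 mulrC => /eqP.
(* If [b = 0], then [b^-1] is [0] by convention, which is integral. *)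
have [->|b0] := eqVneq b 0; first by rewrite invr0 => _; apply: vintegral0.
move=> e; have -> : b^-1 = - (q^L).[b] * (p.[0]^-1)%:A.
  apply: (mulfI b0); rewrite divff // mulrA mulrN e opprK -(rmorphM (in_alg L)).
  by rewrite divff ?rmorph1 //; case: pu.
apply: vintegralM.
  by apply: vintegralN; apply: vintegral_horner => // i; apply: vintegral_coef.
by apply: vintegral_ge0; apply/val_unit_ge0/val_unitV.
Qed.

(** The chain rule again: [b] and its successive images are roots of shorter and shorter iterates,
    whose constant terms are units, so [root_unit] applies to each. *)
Lemma deriv_root_unit cs (b : L) : {in cs, forall c, val_ge0 v c} ->
  (forall k, (0 < k <= size cs)%N -> val_unit (unicrit d (take k cs)).[0]) ->
  root (unicrit d cs)^L b -> int ((unicrit d cs)^L^`().[b])^-1.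
Proof.
elim/last_ind: cs b => [|cs c IH] b hcs hu pb.
  by rewrite map_polyX derivX hornerC invr1; apply: vintegral1.
have hcs' : {in cs, forall c, val_ge0 v c}.
  by move=> c' hc; apply: hcs; rewrite mem_rcons inE hc orbT.
have e : ('X^d + c%:P)^L.[b] = b ^+ d + c%:A.
  by rewrite rmorphD /= map_polyXn map_polyC !hornerE.
have -> : (unicrit d (rcons cs c))^L^`().[b] =
    (unicrit d cs)^L^`().[b ^+ d + c%:A] * (d%:R * b ^+ d.-1).
  rewrite unicrit_rcons map_comp_poly deriv_comp hornerM horner_comp e.
  rewrite [('X^d + c%:P)^L^`()]deriv_map derivD derivXn derivC addr0 rmorphMn /= map_polyXn.
  by rewrite hornerMn hornerXn mulr_natl.
rewrite invfM; apply: vintegralM.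
  apply: IH => //.
    move=> k /andP[k0 ks]; have := hu k; rewrite size_rcons k0 leqW // => /(_ isT).
    by rewrite -cats1 takel_cat.
  by move: pb; rewrite unicrit_rcons map_comp_poly !rootE horner_comp e.
rewrite invfM; apply: vintegralM.
  rewrite -(rmorph_nat (in_alg L)) -fmorphV; apply: vintegral_ge0.
  exact/val_unit_ge0/val_unitV.
rewrite -exprVn; apply: vintegralX; apply: (root_unit _ _ pb).
- exact: unicrit_over.
- exact: monic_unicrit.
- by have := hu (size (rcons cs c)); rewrite take_size size_rcons leqnn; apply.
Qed.

End Unicritical.

(** * The last step of the tower *)

(** [splittingFieldFor] gives the factorization up to a constant, which is [1] for a monic
    polynomial. *)
Lemma splitting_field_roots (K : fieldType) (L : fieldExtType K) (p : {poly K})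
    (E : {subfield L}) : p \is monic -> is_splitting_field p E ->
  exists2 rs : seq L, map_poly (in_alg L) p = \prod_(x <- rs) ('X - x%:P) &
    <<1 & rs>>%VS = E.
Proof.
move=> pm [rs hp hE]; exists rs => //; apply/eqP.
by rewrite -eqp_monic ?monic_prod_XsubC // monic_map.
Qed.

(** * Roots of two consecutive iterates *)

Section Radicals.

Variables (K : fieldType) (d : nat) (cs : seq K) (c : K) (L : fieldExtType K).
Hypothesis d_gt1 : (1 < d)%N.
Variables (bs xs : seq L).
Hypothesis bsE : map_poly (in_alg L) (unicrit d cs) = \prod_(b <- bs) ('X - b%:P).
Hypothesis xsE :
  map_poly (in_alg L) (unicrit d (rcons cs c)) = \prod_(x <- xs) ('X - x%:P).

Lemma size_roots : size bs = (d ^ size cs)%N.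
Proof.
have := congr1 (size : {poly L} -> nat) bsE.
by rewrite size_map_poly size_unicrit // size_prod_XsubC => -[].
Qed.

Lemma root_radical x : x \in xs -> x ^+ d + c%:A \in bs.
Proof.
rewrite -!root_prod_XsubC -bsE -xsE unicrit_rcons map_comp_poly !rootE horner_comp.
by rewrite rmorphD /= map_polyXn map_polyC !hornerE.
Qed.

(** [X^d - (b - c)] is [X - b] composed with [X^d + c], so it divides the next iterate and is a
    product of some of its linear factors, at least one because [d > 0]. *)
Lemma radical_root b : b \in bs -> exists2 x, x \in xs & x ^+ d = b - c%:A.
Proof.
move=> hb.
have : 'X^d - (b - c%:A)%:P %| \prod_(x <- xs) ('X - x%:P).
  have -> : 'X^d - (b - c%:A)%:P = ('X - b%:P) \Po map_poly (in_alg L) ('X^d + c%:P).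
    rewrite (_ : map_poly _ _ = 'X^d + (c%:A)%:P); last first.
      by rewrite rmorphD /= map_polyXn map_polyC.
    rewrite comp_polyB comp_polyX comp_polyC.
    by rewrite polyCB opprB addrA.
  rewrite -xsE unicrit_rcons map_comp_poly; apply: dvdp_comp_poly.
  by rewrite bsE dvdp_XsubCl root_prod_XsubC.
case/dvdp_prod_XsubC => m; case me: (mask m xs) => [|x ys] e.
  by have := eqp_size e; rewrite big_nil size_poly1 (size_XnsubC _ (ltnW d_gt1)) => -[h]; move: (d_gt1); rewrite h.
exists x; first by apply: (@mem_mask _ _ m); rewrite me mem_head.
have : root ('X^d - (b - c%:A)%:P) x by rewrite (eqp_root e) root_prod_XsubC mem_head.
by rewrite rootE !hornerE subr_eq0 => /eqP.
Qed.

Lemma splitting_fields_sub (F E : {subfield L}) :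
  <<1 & bs>>%VS = F -> <<1 & xs>>%VS = E -> (F <= E)%VS.
Proof.
move=> genF genE; rewrite -genF; apply/Fadjoin_seqP; split; first exact: sub1v.
move=> b /radical_root [x hx e].
have -> : b = x ^+ d + c%:A by rewrite e subrK.
apply: memvD; last by apply: memvZ; apply: mem1v.
have xE : x \in E by rewrite -genE seqv_sub_adjoin.
exact: rpredX.
Qed.

End Radicals.

Section LastStep.

Variables (K : fieldType) (v : K -> int) (hv : normalized_valuation v).
Variables (d a : nat) (cs : seq K) (c : K).
Hypothesis d_gt1 : (1 < d)%N.
Hypothesis K_zeta : exists z : K, d.-primitive_root z.
Hypothesis dv : v d%:R = 0.
Hypothesis cs_ge0 : {in cs, forall c, val_ge0 v c}.
Hypothesis c_ge0 : val_ge0 v c.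
Hypothesis irr : irreducible_poly (unicrit d (rcons cs c)).
Hypothesis cs_unit :
  forall k, (0 < k <= size cs)%N -> val_unit v (unicrit d (take k cs)).[0].
Hypothesis c_neq0 : (unicrit d (rcons cs c)).[0] != 0.
Hypothesis c_val : v (unicrit d (rcons cs c)).[0] = a%:Z.
Hypothesis a_gt0 : (0 < a)%N.
Hypothesis a_coprime : coprime a d.
Variables (L : splittingFieldType K) (F E : {subfield L}) (bs xs : seq L).
Hypothesis bsE : map_poly (in_alg L) (unicrit d cs) = \prod_(b <- bs) ('X - b%:P).
Hypothesis xsE :
  map_poly (in_alg L) (unicrit d (rcons cs c)) = \prod_(x <- xs) ('X - x%:P).
Hypothesis genF : <<1 & bs>>%VS = F.
Hypothesis genE : <<1 & xs>>%VS = E.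

Let d_gt0 : (0 < d)%N. Proof. exact: ltnW. Qed.
Let dK : d%:R != 0 :> K. Proof. by case: K_zeta => z /prim_root_natf_neq0. Qed.
Let g := unicrit d cs.
Let f := unicrit d (rcons cs c).

Let gc : g.[c] = f.[0].
Proof. by rewrite /f unicrit_rcons horner_comp !hornerE expr0n eqn0Ngt d_gt0 add0r. Qed.

Lemma galois_splitting (p : {poly K}) (rs : seq L) (M : {subfield L}) :
  separable_poly p -> map_poly (in_alg L) p = \prod_(x <- rs) ('X - x%:P) ->
  <<1 & rs>>%VS = M -> galois 1 M.
Proof.
move=> sp hp hM; apply/splitting_galoisField; exists (map_poly (in_alg L) p); split.
- by apply/polyOver1P; exists p.
- by rewrite separable_map.
- by exists rs => //; rewrite hp eqpxx.
Qed.

Theorem last_step_dim : \dim E = (d ^ (d ^ size cs) * \dim F)%N.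
Proof.
have irrg : irreducible_poly g by apply: irreducible_unicrit_rcons irr.
have sepg : separable_poly g by apply: separable_unicrit.
have sepf : separable_poly f by apply: separable_unicrit.
have gal1F : galois 1 F := galois_splitting sepg bsE genF.
have gal1E : galois 1 E := galois_splitting sepf xsE genE.
have sFE := splitting_fields_sub d_gt1 bsE xsE genF genE.
have galFE : galois F E by apply: galoisS gal1E; rewrite sub1v.
have ubs : uniq bs by rewrite -separable_prod_XsubC -bsE separable_map.
have bs_root b : (b \in bs) = root (map_poly (in_alg L) g) b.
  by rewrite bsE root_prod_XsubC.
have gO : g \is a polyOver (valuation_ring hv) by apply: unicrit_over.
have bs_int : {in bs, forall b, vintegral hv b}.
  move=> b; rewrite bs_root => gb; apply: (vintegral_root_monic _ gb).
    by apply: monic_map; apply: monic_unicrit.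
  by move=> i; apply: vintegral_coef.
(* [g'(b)] is the product of all differences [b - x], and its inverse is integral; multiplying by
   the other differences leaves [(b - b')^-1]. *)
have bs_unit : {in bs &, forall b b', b != b' -> vintegral hv (b - b')^-1}.
  move=> b b' hb hb' bb'.
  have hg : (map_poly (in_alg L) g)^`().[b] = \prod_(x <- bs | x != b) (b - x).
    rewrite bsE deriv_prod_XsubC // (bigD1_seq b) //= [X in _ + X]big1_seq ?addr0 // => x /andP[xb xs_x].
    by rewrite -big_filter (bigD1_seq b) ?filter_uniq ?mem_filter 1?eq_sym ?xb //= subrr mul0r.
  have g0 : (map_poly (in_alg L) g)^`().[b] != 0.
    rewrite hg prodf_seq_neq0; apply/allP => x _; apply/implyP => xb.
    by rewrite subr_eq0 eq_sym.
  have hP : (b - b') * \prod_(x <- [seq x <- bs | x != b] | x != b') (b - x) =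
      (map_poly (in_alg L) g)^`().[b].
    rewrite hg -[RHS]big_filter [RHS](bigD1_seq b') ?filter_uniq //.
    by rewrite mem_filter hb' eq_sym bb'.
  have -> : (b - b')^-1 = \prod_(x <- [seq x <- bs | x != b] | x != b') (b - x) *
      ((map_poly (in_alg L) g)^`().[b])^-1.
    move: g0; rewrite -hP mulf_eq0 negb_or invfM => /andP[_ h0].
    by rewrite mulrCA divff // mulr1.
  apply: vintegralM; last first.
    by apply: deriv_root_unit => //; rewrite -bs_root.
  rewrite big_seq_cond; apply: vintegral_prod => x /andP[]; rewrite mem_filter => /andP[_ hx] _.
  by apply: vintegralB; apply: bs_int.
have bs_gal (s : gal_of F) : {in bs, forall b, s b \in bs}.
  move=> b; rewrite !bs_root => gb.
  have -> : map_poly (in_alg L) g = map_poly s (map_poly (in_alg L) g).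
    rewrite -map_poly_comp; apply: eq_map_poly => x /=.
    by rewrite linearZ /= rmorph1.
  by rewrite fmorph_root.
(* Up to a constant the irreducible [g] is the minimal polynomial of [b], and [F] is normal over
   [K]. *)
have bs_trans : {in bs &, forall b b', exists s : gal_of F, s b = b'}.
  move=> b b' hb hb'.
  have bF : b \in F by rewrite -genF seqv_sub_adjoin.
  have nF : normalField 1 F by case/and3P: gal1F.
  suff mb' : root (minPoly 1 b) b'.
    by have [s _ <-] := normalField_root_minPoly (sub1v _) nF bF mb'; exists s.
  have [q qE] : exists q, minPoly 1%AS b = map_poly (in_alg L) q.
    by apply/polyOver1P; apply: minPolyOver.
  suff qg : q %= g by rewrite qE -(eqp_root (_ : map_poly (in_alg L) g %= _)) -?bs_root // eqp_map eqp_sym.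
  have [_ hirr] := irrg; apply: hirr.
    rewrite -(size_map_poly (in_alg L)) -qE size_minPoly eqSS -lt0n.
    by rewrite adjoin_degreeE divn_gt0 ?adim_gt0 // dimvS // subv_adjoin.
  rewrite -(dvdp_map (in_alg L)) -qE; apply: minPoly_dvdp; last by rewrite -bs_root.
  by apply/polyOver1P; exists g.
have gcE : g.[c] != 0 /\ v g.[c] = a%:Z by rewrite gc.
(* [g(c) = gamma_n(0)] has positive valuation, so [deriv_unicrit_unit] applies at [c]. *)
have gcd : g^`().[c] != 0 /\ v g^`().[c] = 0.
  suff : val_unit v g^`().[c] by [].
  by case: gcE => g0 gv; apply: deriv_unicrit_unit; rewrite ?gv.
have [pi pi0 pi1] := val_surj hv 1.
have indep := @pow_indep K v hv L F bs gal1F genF bs_int bs_unit bs_gal pi pi1 pi0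
   c ubs c_ge0 bs_trans g bsE gcd a d gcE a_coprime d_gt0.
have /fin_all_exists2 [r r_xs rd] (i : 'I_(size bs)) :
    exists2 x, x \in xs & x ^+ d = bs`_i - c%:A.
  by apply: (radical_root d_gt1 bsE xsE); rewrite mem_nth.
have bsF b : b \in bs -> b - c%:A \in F.
  move=> hb; apply: memvB; last by apply: memvZ; apply: mem1v.
  by rewrite -genF seqv_sub_adjoin.
(* [b = c] would give [gamma_n(0) = g(c) = 0]. *)
have bsc0 b : b \in bs -> b - c%:A != 0.
  move=> hb; rewrite subr_eq0; apply: contraNneq c_neq0 => e.
  rewrite -/f -gc -(fmorph_eq0 (in_alg L)) -(horner_map (in_alg L)).
  by move: hb; rewrite bs_root e => /rootP ->.
have [z zp] := K_zeta.
rewrite -(size_roots d_gt1 bsE) -[in (d ^ _)%N](card_ord (size bs)).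
apply: (@kummer_dim K L F E galFE _ r d z%:A) => //.
- by rewrite (fmorph_primitive_root (in_alg L)).
- by apply: memvZ; apply: mem1v.
- move=> i; apply/eqP => r0; have := bsc0 bs`_i; rewrite mem_nth // -rd r0.
  by rewrite expr0n eqn0Ngt d_gt0 eqxx => /(_ isT).
- by move=> i; rewrite rd; apply: bsF; rewrite mem_nth.
- apply/eqP; rewrite eqEsubv; apply/andP; split.
    apply/Fadjoin_seqP; split=> // _ /mapP[i _ ->].
    by rewrite -genE seqv_sub_adjoin.
  rewrite -genE; apply/Fadjoin_seqP; split; first exact: sub1v.
  (* Only one [d]-th root [r j] of each [b_j - c] was chosen; any other root [x] differs from it by
     a power of [z], which lies in [F]. *)
  move=> x hx; have /(nthP 0) [i si e] := root_radical bsE xsE hx.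
  pose j := Ordinal si.
  have rj : r j \in <<F & [seq r i | i <- enum 'I_(size bs)]>>%VS.
    by apply: seqv_sub_adjoin; rewrite map_f ?mem_enum.
  have rj0 : r j ^+ d != 0 by rewrite rd; apply: bsc0; rewrite mem_nth.
  have r0 : r j != 0 by apply: contraNneq rj0 => ->; rewrite expr0n eqn0Ngt d_gt0.
  have : (x / r j) ^+ d = 1.
    by rewrite expr_div_n [r j ^+ d]rd /= e addrK -(addrK c%:A (x ^+ d)) -e divff // -[bs`_i]/(bs`_j) -rd.
  have zpL : d.-primitive_root (z%:A : L) by rewrite (fmorph_primitive_root (in_alg L)).
  move/(prim_rootP zpL) => [k xk]; rewrite -(mulfVK r0 x) xk memvM //.
  by rewrite rpredX // memvZ // mem1v.
- move=> e y yF ye i.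
  (* [pow_indep] wants exponents indexed by elements of [L]; outside [bs] the value [0] is a mere
     default. *)
  pose e' (b : L) := if insub (index b bs) is Some j then e j else 0%N.
  have e'E (j : 'I_(size bs)) : e' bs`_j = e j.
    by rewrite /e' index_uniq // valK.
  rewrite -e'E; apply: (indep e' y yF); last by rewrite mem_nth.
  rewrite ye (big_nth 0) big_mkord; apply: eq_bigr => j _.
  by rewrite rd e'E.
Qed.

End LastStep.

(** * The degree inside an arbitrary extension *)

Theorem last_step_dim_ext (K : fieldType) (v : K -> int)
    (hv : normalized_valuation v) (d a : nat) (cs : seq K) (c : K)
    (L : fieldExtType K) (F E : {subfield L}) :
  (1 < d)%N -> (exists z : K, d.-primitive_root z) -> v d%:R = 0 ->
  {in cs, forall c, val_ge0 v c} -> val_ge0 v c ->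
  irreducible_poly (unicrit d (rcons cs c)) ->
  (forall k, (0 < k <= size cs)%N -> val_unit v (unicrit d (take k cs)).[0]) ->
  (unicrit d (rcons cs c)).[0] != 0 ->
  v (unicrit d (rcons cs c)).[0] = a%:Z -> (0 < a)%N -> coprime a d ->
  is_splitting_field (unicrit d cs) F ->
  is_splitting_field (unicrit d (rcons cs c)) E ->
  (F <= E)%VS /\ \dim_F E = (d ^ (d ^ size cs))%N.
Proof.
move=> d1 hz dv hcs hc irr hu c0 cv a0 ad.
move=> /(splitting_field_roots (monic_unicrit d1 cs)) [bs bsE genF].
move=> /(splitting_field_roots (monic_unicrit d1 (rcons cs c))) [xs xsE genE].
have sFE := splitting_fields_sub d1 bsE xsE genF genE; split=> //.
(* [L] need not be normal over [K], so the Galois theory takes place in [E]. *)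
pose L' := subvs_of E : fieldExtType K.
pose i := linfun (vsval : L' -> L).
have iE x : i x = vsval x by rewrite lfunE.
pose lift (rs : seq L) : seq L' := [seq vsproj E x | x <- rs].
have liftK rs : {subset rs <= E} -> [seq i x | x <- lift rs] = rs.
  move=> h; rewrite -map_comp -[RHS]map_id; apply/eq_in_map => x /h xE.
  by rewrite /= iE vsprojK.
have img rs : {subset rs <= E} -> (i @: <<1 & lift rs>>)%VS = <<1 & rs>>%VS.
  by move=> h; rewrite aimg_adjoin_seq aimg1 liftK.
have liftE (p : {poly K}) rs : {subset rs <= E} ->
    map_poly (in_alg L) p = \prod_(x <- rs) ('X - x%:P) ->
    map_poly (in_alg L') p = \prod_(x <- lift rs) ('X - x%:P).
  move=> h hp; apply: (map_poly_inj (vsval : {rmorphism L' -> L})).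
  rewrite rmorph_prod -map_poly_comp /=.
  transitivity (map_poly (in_alg L) p).
    by apply: eq_map_poly => x /=; rewrite algid1.
  rewrite hp -[in LHS](liftK _ h) big_map; apply: eq_bigr => x _.
  by rewrite map_polyXsubC iE.
have xs_E : {subset xs <= E} by move=> x hx; rewrite -genE seqv_sub_adjoin.
have bs_E : {subset bs <= E}.
  by move=> x hx; apply: (subvP sFE); rewrite -genF seqv_sub_adjoin.
have i0 : lker i == 0%VS by apply/lker0P => x y; rewrite !iE; apply: val_inj.
have genE' : <<1 & lift xs>>%VS = {:L'}%VS.
  apply/eqP; rewrite eqEsubv subvf /=; apply/subvP => x _.
  have : i x \in (i @: <<1 & lift xs>>)%VS by rewrite img // genE iE subvsP.
  by case/memv_imgP => y hy /(lker0P i0) ->.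
(* [E] is itself the splitting field of [gamma_n] over [K]. *)
have ax : SplittingField.axiom L'.
  exists (map_poly (in_alg L') (unicrit d (rcons cs c))).
    by apply/polyOver1P; exists (unicrit d (rcons cs c)).
  by exists (lift xs) => //; rewrite -(liftE _ _ xs_E xsE) eqpxx.
pose L'' : splittingFieldType K :=
  HB.pack (subvs_of E) (FieldExt_isSplittingField.Build K (subvs_of E) ax).
have dimE := @last_step_dim K v hv d a cs c d1 hz dv hcs hc irr hu c0 cv a0 ad
  L'' <<1 & lift bs>>%AS {:L'}%AS (lift bs) (lift xs)
  (liftE _ _ bs_E bsE) (liftE _ _ xs_E xsE) erefl genE'.
(* The inclusion of [E] in [L] is injective, so dimensions computed in [E] hold in [L]. *)
have dim_i (V : {vspace L'}) : \dim (i @: V) = \dim V.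
  by rewrite limg_dim_eq // (eqP i0) capv0.
have <- : \dim {:L'} = \dim E by rewrite -dim_i -genE' img // genE.
have <- : \dim <<1 & lift bs>> = \dim F by rewrite -dim_i img // genF.
by rewrite dimE mulnK // adim_gt0.
Qed.

(** * From the maps [theta_i] to their constants *)

Lemma gamma_unicrit (K : fieldType) (d m : nat) (theta : seq {poly K}) (cs : seq K) :
  theta = [seq 'X^d + c%:P | c <- cs] -> gamma theta m = unicrit d (take m cs).
Proof. by move=> ->; rewrite /gamma -map_take foldr_map. Qed.

Theorem theorem6p3 (K : fieldType) (OK : K -> Prop) (hK : base_field OK)
    (d s : nat) (hd : (2 <= d)%N) (c : s.-tuple K)
    (hzeta : exists z : K, d.-primitive_root z)
    (n : nat) (hn : (2 <= n)%N) (theta : n.-tuple {poly K})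
    (htheta : forall i : 'I_n, exists j : 'I_s,
       tnth theta i = 'X^d + (tnth c j)%:P)
    (hirr : irreducible_poly (gamma theta n))
    (P : K -> Prop) (hP : nonzero_prime_ideal OK P)
    (v : K -> int) (hv : valuation_of_prime OK P v)
    (h1 : v d%:R = 0)
    (h2 : forall i : 'I_s, val_ge0 v (tnth c i))
    (h3 : (gamma theta n).[0] != 0 /\ 0 < v (gamma theta n).[0] /\
          gcdz (v (gamma theta n).[0]) d%:Z = 1)
    (h4 : forall m : nat, (1 <= m <= n - 1)%N ->
       (gamma theta m).[0] != 0 /\ v (gamma theta m).[0] = 0)
    (L : fieldExtType K) (F E : {subfield L})
    (hF : is_splitting_field (gamma theta (n - 1)) F)
    (hE : is_splitting_field (gamma theta n) E) :
  (F <= E)%VS /\ \dim_F E = (d ^ (d ^ (n - 1)))%N.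
Proof.
have /fin_all_exists [j hj] := htheta.
pose all_cs := [seq tnth c (j i) | i <- enum 'I_n].
have size_cs : size all_cs = n by rewrite size_map size_enum_ord.
have thetaE : theta = [seq 'X^d + x%:P | x <- all_cs] :> seq _.
  rewrite -map_comp -[LHS]map_tnth_enum; exact: eq_map.
have cs_ge0 : {in all_cs, forall x, val_ge0 v x} by move=> _ /mapP[i _ ->].
have gE m : gamma theta m = unicrit d (take m all_cs) by apply: gamma_unicrit.
(* [theta_n] is the innermost map, so its constant is split off at the right end. *)
case: (lastP all_cs) size_cs cs_ge0 gE {thetaE} => [|cs c0].
  by move=> n0; have : (1 < size (@nil K))%N by rewrite n0.
move=> nE cs_ge0 gE.
have n1 : (n - 1 = size cs)%N by rewrite -nE size_rcons subn1.
rewrite n1 in h4 hF *.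
have gn : gamma theta n = unicrit d (rcons cs c0).
  by rewrite gE take_oversize // nE.
have gm m : (m <= size cs)%N -> gamma theta m = unicrit d (take m cs).
  by move=> hm; rewrite gE -cats1 takel_cat.
case: hv => hnv _; case: h3 => [gn0 [gnv gcd1]].
rewrite gn in hirr gn0 gnv gcd1 hE.
rewrite gm // take_size in hF.
have [a av] : exists a : nat, v (unicrit d (rcons cs c0)).[0] = a%:Z.
  by exists `|v (unicrit d (rcons cs c0)).[0]|%N; rewrite gez0_abs // ltW.
rewrite av in gnv gcd1.
apply: (last_step_dim_ext hnv) hd hzeta h1 _ _ hirr _ gn0 av gnv _ hF hE.
- by move=> x hx; apply: cs_ge0; rewrite mem_rcons inE hx orbT.
- by apply: cs_ge0; rewrite mem_rcons mem_head.
- by move=> k /andP[k0 ks]; rewrite -gm //; apply: h4; rewrite k0.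
- by move: gcd1; rewrite /gcdz /= => -[] /eqP.
Qed.
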